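(* Let $\mathcal{G} = (\mathcal{V},\mathcal{E})$ be a simple directed graph and let $\mathcal{U}, \mathcal{W} \subseteq \mathcal{V}$. Let $\mathcal{D}(\mathcal{W})$ be any derived vertex set of $\mathcal{W}$ with respect to $\mathcal{U}$ (obtained from $\mathcal{G}$ and $\mathcal{W}$ by the graph simplification process). Then $\operatorname{rank} T_{\mathcal{W},\mathcal{U}}(z;G) = |\mathcal{U}|$ for all $G(z) \in \mathcal{A}(\mathcal{G})$ if and only if $\mathcal{U} \subseteq \mathcal{D}(\mathcal{W})$.
   Context: Graphs: $\mathcal{G}=(\mathcal{V},\mathcal{E})$ is a finite directed graph with vertex set $\mathcal{V}=\{1,\dots,n\}$ and edge set $\mathcal{E}\subseteq\mathcal{V}\times\mathcal{V}$; it is simple, i.e. without self-loops and with at most one edge from one node to another. An edge $(i,j)$ is an outgoing edge of $i$, and $i$ is then an in-neighbour of $j$. $\mathcal{N}_k^-$ is the set of in-neighbours of $k$. A path is a set of edges $\{(v_i,v_{i+1}) : i=1,\dots,k\}\subseteq\mathcal{E}$ with $v_1,\dots,v_{k+1}$ distinct; it has starting node $v_1$ and end node $v_{k+1}$. A node $j$ is reachable from $\mathcal{U}\subseteq\mathcal{V}$ if $j\in\mathcal{U}$ (by convention) or there is a path from some node of $\mathcal{U}$ to $j$. Admissible network matrices: $\mathcal{A}(\mathcal{G})$ is the set of all $n\times n$ matrices $G(z)$ such that (P1) every entry $G_{ij}(z)$ is a proper rational function of $z$ with real coefficients (degree of numerator at most degree of denominator); (P2) $G_{ij}(z)$ is nonzero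 if and only if $(j,i)\in\mathcal{E}$; (P3) every principal minor of $\lim_{z\to\infty}(I-G(z))$ is nonzero. Transfer matrices: for $G\in\mathcal{A}(\mathcal{G})$, $T(z;G):=(I-G(z))^{-1}$. For $\mathcal{W},\mathcal{U}\subseteq\mathcal{V}$, $T_{\mathcal{W},\mathcal{U}}(z;G)$ is the submatrix of $T(z;G)$ with rows indexed by $\mathcal{W}$ and columns indexed by $\mathcal{U}$. The rank of a rational matrix $A(z)$ means its normal rank, $\max_{\lambda\in\mathbb{C}}\operatorname{rank}A(\lambda)$ (the rank over the field of rational functions). Graph simplification process (for given $\mathcal{G}$ and $\mathcal{U},\mathcal{W}\subseteq\mathcal{V}$): consider the following two operations on the current graph and the current set $\mathcal{W}$. (1) Remove all outgoing edges of nodes in $\mathcal{W}$ from the graph. (2) If some $k\in\mathcal{W}\setminus\mathcal{U}$ has exactly one in-neighbour $j\in\mathcal{N}_k^-$ that is reachable from $\mathcal{U}$ (in-neighbours and reachability taken in the current graph), replace $k$ by $j$ in $\mathcal{W}$, i.e. replace $\mathcal{W}$ by $(\mathcal{W}\setminus\{k\})\cup\{j\}$. Operations 1 and 2 are applied consecutively, in any order, until no more changes are possible. Any final vertex set obtained this way is called a derived vertex set of $\mathcal{W}$ with respect to $\mathcal{U}$ and denoted $\mathcal{D}(\mathcal{W})$; it need not be unique, as it may depend on the order of operations. *)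

(* Defs.v *)
From Stdlib Require Import Relation_Operators.
From mathcomp Require Import all_boot all_order all_algebra.
From mathcomp Require Import generic_quotient fraction.
From mathcomp Require Import reals complex.

Set Implicit Arguments.
Unset Strict Implicit.
Unset Printing Implicit Defensive.

Import Order.TTheory GRing.Theory Num.Theory.
Local Open Scope ring_scope.
Local Open Scope complex_scope.
Local Open Scope quotient_scope.

(* A digraph on the vertices 'I_n is its set of edges; (i, j) is an edge from *)
(* i to j.                                                                    *)
Definition simple_digraph n (E : {set 'I_n * 'I_n}) : Prop :=
  forall i, (i, i) \notin E.

Definition edge_rel n (E : {set 'I_n * 'I_n}) : rel 'I_n :=
  fun i j => (i, j) \in E.

Definition reachable n (E : {set 'I_n * 'I_n}) (U : {set 'I_n}) (j : 'I_n) :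
    Prop :=
  j \in U \/
  exists u (p : seq 'I_n),
    [/\ u \in U, path (edge_rel E) u p, uniq (u :: p) & last u p = j].

Definition remove_out_edges n (E : {set 'I_n * 'I_n}) (W : {set 'I_n}) :
    {set 'I_n * 'I_n} :=
  [set e in E | e.1 \notin W].

Definition unique_reachable_in_neighbour n (E : {set 'I_n * 'I_n})
    (U : {set 'I_n}) (k j : 'I_n) : Prop :=
  unique (fun i => (i, k) \in E /\ reachable E U i) j.

(* The state of the simplification process is the pair of the current edge    *)
(* set and the current vertex set.                                            *)
Inductive simplification_step n (U : {set 'I_n}) :
    {set 'I_n * 'I_n} * {set 'I_n} -> {set 'I_n * 'I_n} * {set 'I_n} -> Prop :=
| RemoveOutEdges E W :
    simplification_step U (E, W) (remove_out_edges E W, W)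
| ReplaceVertex E W k j :
    k \in W :\: U -> unique_reachable_in_neighbour E U k j ->
    simplification_step U (E, W) (E, j |: (W :\ k)).

Definition derived_vertex_set n (E : {set 'I_n * 'I_n}) (U W D : {set 'I_n}) :
    Prop :=
  exists E' : {set 'I_n * 'I_n},
    clos_refl_trans _ (simplification_step U) (E, W) (E', D) /\
    forall s, simplification_step U (E', D) s -> s = (E', D).

Definition ratfun (R : realType) := {fraction {poly R}}.

Definition proper (R : realType) (g : ratfun R) : Prop :=
  exists p q : {poly R},
    [/\ q != 0, g = tofrac p / tofrac q & (size p <= size q)%N].

(* The representative of g chosen by repr need not be in lowest terms, and    *)
(* division by zero yields 0, so this is the true value of g only away from   *)
(* the roots of the chosen denominator. They are finite in number, hence      *)
(* irrelevant to the behaviour at infinity.                                   *)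
Definition ratfun_eval (R : realType) (g : ratfun R) (z : R[i]) : R[i] :=
  (map_poly (real_complex R) (\n_(repr g))).[z] /
  (map_poly (real_complex R) (\d_(repr g))).[z].

Definition tends_at_infinity (R : realType) (f : R[i] -> R[i]) (l : R[i]) :
    Prop :=
  forall e : R, 0 < e ->
    exists M : R, forall z : R[i], M%:C < `|z| -> `|f z - l| < e%:C.

Definition submx_of (T : Type) n (A : 'M[T]_n) (W U : {set 'I_n}) :
    'M[T]_(#|W|, #|U|) :=
  mxsub enum_val enum_val A.

Record admissible (R : realType) n (E : {set 'I_n * 'I_n})
    (G : 'M[ratfun R]_n) : Prop := Admissible {
  admissible_proper : forall i j, proper (G i j);
  admissible_support : forall i j, G i j != 0 <-> (j, i) \in E;
  admissible_minors : exists L : 'M[R[i]]_n,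
    (forall i j,
       tends_at_infinity (ratfun_eval ((1%:M - G : 'M[ratfun R]_n) i j))
                         (L i j)) /\
    (forall S : {set 'I_n}, \det (submx_of L S S) != 0)
}.

Definition transfer_matrix (R : realType) n (G : 'M[ratfun R]_n) :
    'M[ratfun R]_n :=
  invmx (1%:M - G).

(* Main.v *)
Require Import Defs.
From Stdlib Require Import Relation_Operators.
From mathcomp Require Import all_boot all_order all_algebra.
From mathcomp Require Import generic_quotient fraction.
From mathcomp Require Import reals complex.
From mathcomp Require Import ring lra zify.

(** The inverse matrix can be eliminated from the problem. Writing x = T v, the
rank of the W-by-U block of T = (I - G)^-1 is #|U| exactly when no nonzero x
satisfies the network equations x = G x outside U and vanishes on W
([rank_transfer_observable]); call this property observability of W from U.
Likewise, nonzero principal minors of I - G mean that for every vertex set S,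
only x = 0 can be supported on S and satisfy x = G x on S
([principally_regular]).

In these terms each simplification step visibly preserves observability, for
each fixed G restricted to the current edges ([simplification_observable]):
- removing the edges out of W changes G x only through entries x_i with i in W,
  and those are zero;
- if j is the only in-neighbour of k reachable from U, then x vanishes at the
  unreachable vertices, so the equation at k reads x_k = G_kj x_j with
  G_kj <> 0, and x vanishes at k exactly when it vanishes at j.
So only the final pair (E', D) matters. If U is contained in D, observability
is regularity applied to the complement of D ([regular_observable]).

Suppose U is not contained in D. In the final graph no edge leaves D, and every
vertex of D outside U has either no or at least two in-neighbours reachable
from U. An admissible G with a nonzero hidden state x, vanishing on D, is then
built as follows. Let x_i = t^(d i) at the reachable vertices i outside D and
zero elsewhere, where d is the distance from U. All weights are high powers of
t, except that for each i outside U with a reachable in-neighbour one weight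
G_ij is solved for from the equation at i: for i outside D, j is a predecessor
on a shortest path and the solution is t^(d i - d j) up to higher powers; for i
in D the solution is minus a nonempty sum of powers of t, so nonzero
([polynomial_hidden_state]). All weights vanish at t = 0, where I - G becomes
I, so all principal minors are nonzero polynomials in t. A real value of t that
is not a root of any of the finitely many polynomials concerned gives a
constant real G ([hidden_state]).

Every admissible G is regular because a matrix of rational functions whose
limit at infinity is invertible is itself invertible ([det_ratfun_neq0]). *)

Set Implicit Arguments.
Unset Strict Implicit.
Unset Printing Implicit Defensive.

Import Order.TTheory GRing.Theory Num.Theory.
Local Open Scope ring_scope.
Local Open Scope complex_scope.
Local Open Scope quotient_scope.

(** * The network equations *)

(** The inverse-free form of nonvanishing principal minors of I - G: a kernel
vector of the S-by-S block is a vector y supported on S with y = G y on S. *)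
Definition principally_regular (F : fieldType) n (G : 'M[F]_n) : Prop :=
  forall (S : {set 'I_n}) (y : 'cV[F]_n),
    (forall i, i \notin S -> y i 0 = 0) ->
    (forall i, i \in S -> y i 0 = (G *m y) i 0) -> y = 0.

(** Such an x is T v for some v supported on U; observability from U through W
means that v can be recovered from the entries of T v in W. *)
Definition observable (F : fieldType) n (G : 'M[F]_n) (U W : {set 'I_n}) :
    Prop :=
  forall x : 'cV[F]_n,
    (forall i, i \notin U -> x i 0 = (G *m x) i 0) ->
    (forall i, i \in W -> x i 0 = 0) -> x = 0.

Definition supported_on (F : nzRingType) n (E : {set 'I_n * 'I_n})
    (G : 'M[F]_n) : Prop :=
  forall i j, G i j != 0 <-> (j, i) \in E.

Definition restrict_edges (F : nzRingType) n (E : {set 'I_n * 'I_n})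
    (G : 'M[F]_n) : 'M[F]_n :=
  \matrix_(i, j) (if (j, i) \in E then G i j else 0).

Lemma submx_of_mulmx (F : fieldType) n (A : 'M[F]_n) (W U : {set 'I_n})
    (v : 'cV[F]_n) :
  (forall i, i \notin U -> v i 0 = 0) ->
  submx_of A W U *m rowsub enum_val v = rowsub enum_val (A *m v).
Proof.
move=> vU; apply/matrixP=> i j; rewrite !ord1 !mxE.
rewrite (bigID (mem U)) /= [X in _ = _ + X]big1 ?addr0; last first.
  by move=> k /vU->; rewrite mulr0.
rewrite (eq_bigl (mem U)) // [RHS]big_enum_val.
by apply: eq_bigr => k _; rewrite !mxE.
Qed.

Lemma rowsub_enum_val_eq0 (F : fieldType) n (U : {set 'I_n}) (v : 'cV[F]_n) :
  rowsub (enum_val : 'I_#|U| -> 'I_n) v = 0 ->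
  forall i, i \in U -> v i 0 = 0.
Proof.
move=> v0 i iU; have /matrixP/(_ (enum_rank_in iU i) 0) := v0.
by rewrite !mxE enum_rankK_in.
Qed.

Lemma principal_minors_regular (F : fieldType) n (G : 'M[F]_n) :
  (forall S : {set 'I_n}, \det (submx_of (1%:M - G) S S) != 0) ->
  principally_regular G.
Proof.
move=> minors S y yS Gy.
suff y0 : rowsub (enum_val : 'I_#|S| -> 'I_n) y = 0.
  apply/colP=> i; rewrite mxE; case: (boolP (i \in S)) => [|/yS //].
  exact: rowsub_enum_val_eq0 y0 i.
have My : submx_of (1%:M - G) S S *m rowsub enum_val y = 0.
  rewrite submx_of_mulmx //; apply/matrixP=> i j.
  rewrite !ord1 [LHS]mxE mulmxBl mul1mx [LHS]mxE [X in _ + X]mxE.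
  by rewrite Gy ?enum_valP // addrN mxE.
have MU : submx_of (1%:M - G) S S \in unitmx by rewrite unitmxE unitfE.
by rewrite -[LHS](mulKmx MU) My mulmx0.
Qed.

(** The case where S is the whole vertex set. *)
Lemma regular_unitmx (F : fieldType) n (G : 'M[F]_n) :
  principally_regular G -> 1%:M - G \in unitmx.
Proof.
move=> reg; rewrite -unitmx_tr -row_free_unit -kermx_eq0.
apply/rowV0P=> u /sub_kermxP /(congr1 trmx).
rewrite trmx_mul trmxK trmx0 mulmxBl mul1mx => /eqP.
rewrite subr_eq0 => /eqP Gu.
apply: trmx_inj; rewrite trmx0; apply: (reg [set: 'I_n]) => i.
  by rewrite inE.
by move=> _; rewrite -Gu.
Qed.

(** The substitution x = T v, v = (I - G) x turns injectivity of the block of T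
on vectors supported on U into observability. *)
Lemma rank_transfer_observable (R : realType) n (G : 'M[ratfun R]_n)
    (U W : {set 'I_n}) :
  1%:M - G \in unitmx ->
  \rank (submx_of (transfer_matrix G) W U) = #|U| <-> observable G U W.
Proof.
move=> GU; rewrite /transfer_matrix; set T := invmx _; split=> [rk x xU xW|obs].
  pose v := (1%:M - G) *m x.
  have Tv : T *m v = x by rewrite mulKmx.
  have vU i : i \notin U -> v i 0 = 0.
    by move=> /xU iU; rewrite /v mulmxBl mul1mx !mxE iU mxE subrr.
  have free : row_free (submx_of T W U)^T by rewrite /row_free mxrank_tr rk.
  suff v0 : rowsub (enum_val : 'I_#|U| -> 'I_n) v = 0.
    rewrite -Tv (_ : v = 0) ?mulmx0 //; apply/colP=> i; rewrite [RHS]mxE.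
    by case: (boolP (i \in U)) => [|/vU //]; apply: rowsub_enum_val_eq0 v0 i.
  apply: trmx_inj; apply: (row_free_inj free).
  rewrite -trmx_mul trmx0 mul0mx submx_of_mulmx // Tv.
  by apply/matrixP=> i j; rewrite !ord1 !mxE xW ?enum_valP.
rewrite -mxrank_tr; apply/eqP; rewrite -/(row_free _) -kermx_eq0.
apply/rowV0P=> u /sub_kermxP /(congr1 trmx); rewrite trmx_mul trmxK trmx0 => Mu.
pose v : 'cV_n := \col_i \sum_(k < #|U|) (enum_val k == i)%:R * u 0 k.
have vE k : v (enum_val k) 0 = u 0 k.
  rewrite mxE (bigD1 k) //= eqxx mul1r big1 ?addr0 // => l lk.
  by rewrite (inj_eq enum_val_inj) (negPf lk) mul0r.
have vU i : i \notin U -> v i 0 = 0.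
  move=> iU; rewrite mxE big1 // => k _.
  by case: eqP => [ki|_]; [rewrite -ki enum_valP in iU | rewrite mul0r].
have uE : u^T = rowsub enum_val v by apply/colP=> k; rewrite !mxE -vE mxE.
suff Tv0 : T *m v = 0.
  have v0 : v = 0 by rewrite -[v](mulKVmx GU) -/T Tv0 mulmx0.
  by apply/rowP=> k; rewrite -vE v0 !mxE.
apply: obs => [i iU|].
  have : ((1%:M - G) *m (T *m v)) i 0 = 0 by rewrite mulKVmx // vU.
  by rewrite mulmxBl mul1mx !mxE => /eqP; rewrite subr_eq0 => /eqP.
by apply: rowsub_enum_val_eq0; rewrite -(submx_of_mulmx T W vU) -uE.
Qed.

(** * Invariance under simplification *)

Lemma reachableP n (E : {set 'I_n * 'I_n}) (U : {set 'I_n}) j :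
  reflect (reachable E U j) [exists u in U, connect (edge_rel E) u j].
Proof.
apply: (iffP exists_inP) => [[u uU /connectP[p pE ->]]|].
  by right; case/shortenP: pE => q qE uq _; exists u, q.
case=> [jU|[u [p [uU pE _ <-]]]]; first by exists j.
by exists u => //; apply/connectP; exists p.
Qed.

Lemma reachable_edge n (E : {set 'I_n * 'I_n}) (U : {set 'I_n}) i j :
  reachable E U i -> (i, j) \in E -> reachable E U j.
Proof.
move=> /reachableP/exists_inP[u uU ui] ij; apply/reachableP/exists_inP.
by exists u => //; apply: connect_trans ui (connect1 _).
Qed.

(** The unreachable vertices lie outside U and have only unreachable
in-neighbours, so x cut down to them solves a closed homogeneous system, to
which regularity applies. *)
Lemma unreachable_zero (F : fieldType) n (E : {set 'I_n * 'I_n})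
    (U : {set 'I_n}) (G : 'M[F]_n) (x : 'cV[F]_n) :
  principally_regular G -> supported_on E G ->
  (forall i, i \notin U -> x i 0 = (G *m x) i 0) ->
  forall i, ~ reachable E U i -> x i 0 = 0.
Proof.
move=> reg supp xU i iN.
pose r j := [exists u in U, connect (edge_rel E) u j].
(* The restriction of x to the unreachable vertices. *)
pose y : 'cV[F]_n := \col_j (if r j then 0 else x j 0).
suff y0 : y = 0.
  move/colP/(_ i): y0; rewrite !mxE; case: ifP => // ri.
  by case: iN; apply/reachableP.
apply: (reg [set j | ~~ r j]) => j; rewrite !inE.
  by rewrite negbK mxE => ->.
move=> rj; have jU : j \notin U.
  by apply: contra rj => jU; apply/exists_inP; exists j.
rewrite [LHS]mxE (negPf rj) xU // !mxE; apply: eq_bigr => k _; rewrite mxE.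
case: ifP => // rk; suff -> : G j k = 0 by rewrite !mul0r.
apply/eqP; apply: contraNT rj => /supp kj.
by apply/reachableP; apply: reachable_edge kj; apply/reachableP.
Qed.

(** Deleting the columns in W makes the S-by-S block block triangular, with
an identity block on S :&: W. In terms of vectors: if y solves the
system without the edges out of W, then y with its W entries set to zero solves
the original system on S :\: W. *)
Lemma regular_remove_out_edges (F : fieldType) n (E : {set 'I_n * 'I_n})
    (W : {set 'I_n}) (G : 'M[F]_n) :
  principally_regular (restrict_edges E G) ->
  principally_regular (restrict_edges (remove_out_edges E W) G).
Proof.
move=> reg S y yS Gy.
pose y' : 'cV[F]_n := \col_j (if j \in W then 0 else y j 0).
have GyE : restrict_edges (remove_out_edges E W) G *m y =
           restrict_edges E G *m y'.
  apply/colP=> i; rewrite !mxE; apply: eq_bigr => j _; rewrite !mxE !inE /=.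
  by case: (j \in W); rewrite /= ?andbF ?andbT ?mulr0 ?mul0r.
suff y'0 : y' = 0.
  apply/colP=> i; rewrite mxE; case: (boolP (i \in S)) => [/Gy->|/yS //].
  by rewrite GyE y'0 mulmx0 mxE.
apply: (reg (S :\: W)) => i; rewrite !inE.
  by rewrite negb_and negbK mxE => /orP[->|/yS->] //; rewrite if_same.
by case/andP=> /negPf iW iS; rewrite [LHS]mxE iW Gy // GyE.
Qed.

(** The deleted columns are multiplied by entries of x that are zero. *)
Lemma observable_remove_out_edges (F : fieldType) n (E : {set 'I_n * 'I_n})
    (U W : {set 'I_n}) (G : 'M[F]_n) :
  observable (restrict_edges (remove_out_edges E W) G) U W <->
  observable (restrict_edges E G) U W.
Proof.
have GE (x : 'cV[F]_n) : (forall i, i \in W -> x i 0 = 0) ->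
    restrict_edges (remove_out_edges E W) G *m x = restrict_edges E G *m x.
  move=> xW; apply/colP=> i; rewrite !mxE; apply: eq_bigr => j _.
  by rewrite !mxE inE /=; case: (boolP (j \in W)) => [/xW->|_];
    rewrite ?mulr0 ?andbT.
split=> obs x xU xW; apply: obs => // i iU; first by rewrite GE ?xU.
by rewrite -GE ?xU.
Qed.

(** All terms of the equation at k vanish except the one at j, so
x_k = G_kj x_j. *)
Lemma observable_replace (F : fieldType) n (E : {set 'I_n * 'I_n})
    (U W : {set 'I_n}) (G : 'M[F]_n) k j :
  principally_regular G -> supported_on E G ->
  k \in W :\: U -> unique_reachable_in_neighbour E U k j ->
  observable G U (j |: (W :\ k)) <-> observable G U W.
Proof.
move=> reg supp; rewrite inE => /andP[kU kW] [[jk _] juniq].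
suff kE (x : 'cV[F]_n) : (forall i, i \notin U -> x i 0 = (G *m x) i 0) ->
    x k 0 = G k j * x j 0.
  split=> obs x xU xW; apply: obs => // i.
    rewrite !inE => /orP[/eqP->|/andP[_ /xW //]]; apply/eqP.
    have /eqP := kE x xU; rewrite xW // eq_sym mulf_eq0 => /orP[Gkj|//].
    by have := (supp k j).2 jk; rewrite Gkj.
  move=> iW; have [->|ik] := eqVneq i k.
    by rewrite kE // xW ?mulr0 // !inE eqxx.
  by apply: xW; rewrite !inE ik iW orbT.
move=> xU; rewrite xU // mxE (bigD1 j) //= big1 ?addr0 // => i ij.
have [->|/supp ik] := eqVneq (G k i) 0; first by rewrite mul0r.
rewrite (unreachable_zero reg supp xU) ?mulr0 // => ri.
by rewrite (juniq i (conj ik ri)) eqxx in ij.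
Qed.

Lemma map_restrict_edges (F F' : nzRingType) n (f : F -> F')
    (E : {set 'I_n * 'I_n}) (G : 'M[F]_n) :
  f 0 = 0 -> restrict_edges E (map_mx f G) = map_mx f (restrict_edges E G).
Proof. by move=> f0; apply/matrixP=> i j; rewrite !mxE; case: ifP. Qed.

Lemma supported_restrict_edges (F : fieldType) n (E E' : {set 'I_n * 'I_n})
    (G : 'M[F]_n) :
  supported_on E G -> E' \subset E -> supported_on E' (restrict_edges E' G).
Proof.
move=> supp /subsetP sub i j; rewrite mxE; case: ifP => [/sub/supp ->//|].
by rewrite eqxx.
Qed.

Lemma restrict_edges_id (F : fieldType) n (E : {set 'I_n * 'I_n})
    (G : 'M[F]_n) : supported_on E G -> restrict_edges E G = G.
Proof.
move=> supp; apply/matrixP=> i j; rewrite mxE; case: ifP => // ji.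
by apply/esym/eqP; apply: contraFT ji => /supp.
Qed.

Lemma simplification_subset n (U : {set 'I_n})
    (s s' : {set 'I_n * 'I_n} * {set 'I_n}) :
  clos_refl_trans _ (simplification_step U) s s' -> s'.1 \subset s.1.
Proof.
elim=> {s s'} [s s' []//= E1 W1|s|s1 s2 s3 _ sub2 _ sub3] //.
  by apply/subsetP=> e; rewrite inE => /andP[].
exact: subset_trans sub3 sub2.
Qed.

Lemma simplification_observable (F : fieldType) n (U : {set 'I_n})
    (E : {set 'I_n * 'I_n}) (G : 'M[F]_n) s s' :
  supported_on E G ->
  clos_refl_trans _ (simplification_step U) s s' -> s.1 \subset E ->
  principally_regular (restrict_edges s.1 G) ->
  principally_regular (restrict_edges s'.1 G) /\
  (observable (restrict_edges s'.1 G) U s'.2 <->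
   observable (restrict_edges s.1 G) U s.2).
Proof.
move=> supp; elim=> {s s'} [s s' [E1 W1|E1 W1 k j kW jk] /= sub reg||].
- split; first exact: regular_remove_out_edges.
  exact: observable_remove_out_edges.
- split=> //; apply: observable_replace kW jk => //.
  exact: supported_restrict_edges supp sub.
- by move=> s sub reg; split.
move=> s1 s2 s3 steps IH1 _ IH2 sub reg.
have [reg2 obs2] := IH1 sub reg.
have [|reg3 obs3] := IH2 _ reg2.
  exact: subset_trans (simplification_subset steps) sub.
by split=> //; apply: iff_trans obs3 obs2.
Qed.

(** A vector satisfying the hypotheses of observability is supported on the
complement of D, which is disjoint from U, and solves the system there. *)
Lemma regular_observable (F : fieldType) n (G : 'M[F]_n) (U D : {set 'I_n}) :
  principally_regular G -> U \subset D -> observable G U D.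
Proof.
move=> reg /subsetP UD x xU xD; apply: (reg (~: D)) => i; rewrite inE.
  by rewrite negbK => /xD.
by move=> iD; apply: xU; apply: contra iD => /UD.
Qed.

(** * Limits at infinity *)

Lemma tends_cst (R : realType) (l : R[i]) : tends_at_infinity (fun=> l) l.
Proof. by move=> e e0; exists 0 => z _; rewrite subrr normr0 ltcR. Qed.

Lemma eventually_and (R : realType) (P Q : R[i] -> Prop) :
  (exists M : R, forall z, M%:C < `|z| -> P z) ->
  (exists M : R, forall z, M%:C < `|z| -> Q z) ->
  exists M : R, forall z, M%:C < `|z| -> P z /\ Q z.
Proof.
move=> [M1 P1] [M2 Q2]; exists (Num.max M1 M2) => z zM; split.
  by apply: P1; apply: le_lt_trans zM; rewrite lecR le_max lexx.
by apply: Q2; apply: le_lt_trans zM; rewrite lecR le_max lexx orbT.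
Qed.

Lemma eventually_ex (R : realType) (P : R[i] -> Prop) :
  (exists M : R, forall z, M%:C < `|z| -> P z) -> exists c : R, P c%:C.
Proof.
move=> [M PM]; exists (`|M| + 1); apply: PM.
have pos : 0 <= `|M| + 1 :> R by rewrite addr_ge0.
rewrite ger0_norm ?ler0c // ltcR.
by rewrite (le_lt_trans (ler_norm M)) // ltrDl.
Qed.

Lemma tendsD (R : realType) (f g : R[i] -> R[i]) l m :
  tends_at_infinity f l -> tends_at_infinity g m ->
  tends_at_infinity (fun z => f z + g z) (l + m).
Proof.
move=> fl gm e e0; have e2 : 0 < e / 2 by rewrite divr_gt0.
have [M H] := eventually_and (fl _ e2) (gm _ e2).
exists M => z /H[flz gmz]; rewrite opprD addrACA.
apply: (le_lt_trans (ler_normD _ _)); rewrite (splitr e) rmorphD /=.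
exact: ltrD.
Qed.

Lemma tendsM (R : realType) (f g : R[i] -> R[i]) l m :
  tends_at_infinity f l -> tends_at_infinity g m ->
  tends_at_infinity (fun z => f z * g z) (l * m).
Proof.
move=> fl gm e e0.
have /complex_realP[a la] : `|l| \is Num.real by exact: normr_real.
have /complex_realP[b mb] : `|m| \is Num.real by exact: normr_real.
have a0 : 0 <= a by rewrite -ler0c -la normr_ge0.
have b0 : 0 <= b by rewrite -ler0c -mb normr_ge0.
have s0 : 0 < 1 + a + b + e by lra.
(* This choice gives d < 1 and d (d + a + b) < e, where d (d + a + b) bounds
   the distance from f z g z to l m once f z and g z are within d of l and m. *)
pose d := e / (1 + a + b + e).
have d0 : 0 < d by rewrite divr_gt0.
have d1 : d < 1 by rewrite ltr_pdivrMr //; lra.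
have dE : d * (1 + a + b + e) = e by rewrite mulfVK // lt0r_neq0.
clearbody d.
have [M H] := eventually_and (fl _ d0) (gm _ d0).
exists M => z /H[flz gmz].
have -> : f z * g z - l * m =
    (f z - l) * (g z - m) + ((f z - l) * m + l * (g z - m)) by ring.
have lt_d : d * d + (d * b + a * d) < e by nra.
apply: (@le_lt_trans _ _ (d * d + (d * b + a * d))%:C); last first.
  by rewrite ltcR.
rewrite !rmorphD !rmorphM /=.
apply: (le_trans (ler_normD _ _)); rewrite lerD //.
  by rewrite normrM; apply: ler_pM; rewrite ?normr_ge0 // ltW.
apply: (le_trans (ler_normD _ _)); rewrite !normrM la mb lerD //.
  by rewrite ler_wpM2r ?ler0c // ltW.
by rewrite ler_wpM2l ?ler0c // ltW.
Qed.

Lemma tends_at_infinity_eq (R : realType) (f g : R[i] -> R[i]) l :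
  f =1 g -> tends_at_infinity f l -> tends_at_infinity g l.
Proof.
by move=> fg fl e e0; have [M H] := fl e e0; exists M => z /H; rewrite fg.
Qed.

Lemma tends_sum (R : realType) (I : Type) (r : seq I)
    (f : I -> R[i] -> R[i]) (l : I -> R[i]) :
  (forall i, tends_at_infinity (f i) (l i)) ->
  tends_at_infinity (fun z => \sum_(i <- r) f i z) (\sum_(i <- r) l i).
Proof.
move=> fl; elim: r => [|i r IH].
  rewrite big_nil; apply: tends_at_infinity_eq (tends_cst 0) => z.
  by rewrite big_nil.
rewrite big_cons; apply: tends_at_infinity_eq (tendsD (fl i) IH) => z.
by rewrite big_cons.
Qed.

Lemma tends_prod (R : realType) (I : Type) (r : seq I)
    (f : I -> R[i] -> R[i]) (l : I -> R[i]) :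
  (forall i, tends_at_infinity (f i) (l i)) ->
  tends_at_infinity (fun z => \prod_(i <- r) f i z) (\prod_(i <- r) l i).
Proof.
move=> fl; elim: r => [|i r IH].
  rewrite big_nil; apply: tends_at_infinity_eq (tends_cst 1) => z.
  by rewrite big_nil.
rewrite big_cons; apply: tends_at_infinity_eq (tendsM (fl i) IH) => z.
by rewrite big_cons.
Qed.

Lemma tends_det (R : realType) m (f : R[i] -> 'M[R[i]]_m) (L : 'M[R[i]]_m) :
  (forall i j, tends_at_infinity (fun z => f z i j) (L i j)) ->
  tends_at_infinity (fun z => \det (f z)) (\det L).
Proof.
move=> fL; apply: tends_sum => s; apply: tendsM; first exact: tends_cst.
exact: tends_prod.
Qed.

(** Limits are stated with thresholds on the modulus, so uniqueness of the
limit needs a point beyond two thresholds; a large real number is one. *)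
Lemma tends_eventually_eq0 (R : realType) (f : R[i] -> R[i]) l :
  tends_at_infinity f l ->
  (exists M : R, forall z, M%:C < `|z| -> f z = 0) -> l = 0.
Proof.
move=> fl f0; apply/eqP/contraT => l0.
have /complex_realP[a la] : `|l| \is Num.real by exact: normr_real.
have a0 : 0 < a by rewrite -ltcR -la normr_gt0.
have [c [/[swap] ->]] := eventually_ex (eventually_and (fl a a0) f0).
by rewrite sub0r normrN la ltxx.
Qed.

(** Over the algebraically closed field R[i], every root is bounded in modulus
by the sum of the moduli of all roots. *)
Lemma poly_eventually_neq0 (R : realType) (p : {poly R}) :
  p != 0 ->
  exists M : R, forall z : R[i], M%:C < `|z| ->
    (map_poly (real_complex R) p).[z] != 0.
Proof.
rewrite -(map_poly_eq0 (real_complex R)); set q := map_poly _ _ => q0.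
have [r qr] := closed_field_poly_normal q.
have /complex_realP[a ra] : \sum_(w <- r) `|w| \is Num.real.
  by apply: sum_real => w _; apply: normr_real.
exists a => z az; apply: contraL az => /eqP qz.
have : root q z by apply/eqP.
rewrite qr rootZ ?lead_coef_eq0 // root_prod_XsubC => zr.
suff : `|z| <= a%:C by move=> /le_gtF ->.
by rewrite -ra (big_rem z) //= lerDl sumr_ge0.
Qed.

Lemma poly_nonroot (R : realType) (p : {poly R}) :
  p != 0 -> exists c : R, p.[c] != 0.
Proof.
move=> /poly_eventually_neq0/eventually_ex[c pc]; exists c.
by rewrite horner_map fmorph_eq0 in pc.
Qed.

(** The relation between a fraction and its chosen representative, in a form
that needs no lowest terms. *)
Lemma ratfun_denominator (R : realType) (g : ratfun R) :
  g * tofrac (\d_(repr g)) = tofrac (\n_(repr g)).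
Proof.
rewrite -{1}[g]reprK; unlock tofrac; rewrite -[LHS]FracField.pi_mul.
apply/eqmodP; rewrite /= FracField.equivfE /FracField.mulf.
have d0 := denom_ratioP (repr g).
by rewrite !numden_Ratio ?oner_eq0 ?mulf_neq0 ?oner_eq0 // !mulr1 mulrC.
Qed.

(** Clear denominators: if M is singular over the rational functions, then its
multiple by the product d of all denominators is a singular polynomial matrix.
Evaluation shows that the values of M are singular wherever d does not vanish,
hence near infinity, and so is their limit. *)
Lemma det_ratfun_neq0 (R : realType) m (M : 'M[ratfun R]_m) (L : 'M[R[i]]_m) :
  (forall i j, tends_at_infinity (ratfun_eval (M i j)) (L i j)) ->
  \det L != 0 -> \det M != 0.
Proof.
move=> ML; apply: contraNneq => M0.
pose den (p : 'I_m * 'I_m) := \d_(repr (M p.1 p.2)).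
pose d := \prod_p den p.
pose P : 'M[{poly R}]_m :=
  \matrix_(i, j) (\n_(repr (M i j)) * \prod_(p | p != (i, j)) den p).
have dE i j : d = \d_(repr (M i j)) * \prod_(p | p != (i, j)) den p.
  by rewrite /d (bigD1 (i, j)).
have PM : map_mx (@tofrac {poly R}) P = tofrac d *: M.
  apply/matrixP=> i j; rewrite !mxE (dE i j) !rmorphM /=.
  by rewrite -ratfun_denominator; ring.
have P0 : \det P = 0.
  apply/eqP; rewrite -tofrac_eq0 -[tofrac _]/(tofrac _) -det_map_mx PM.
  by rewrite detZ M0 mulr0.
have d0 : d != 0 by apply/prodf_neq0 => p _; apply: denom_ratioP.
have [B HB] := poly_eventually_neq0 d0.
pose Mz z : 'M[R[i]]_m := \matrix_(i, j) ratfun_eval (M i j) z.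
have MzL i j : tends_at_infinity (fun z => Mz z i j) (L i j).
  by apply: tends_at_infinity_eq (ML i j) => z; rewrite mxE.
apply/eqP; apply: (tends_eventually_eq0 (tends_det MzL)).
exists B => z /HB dz.
pose ev : {poly R} -> R[i] := horner_eval z \o map_poly (real_complex R).
have PMz : map_mx ev P = ev d *: Mz z.
  apply/matrixP=> i j; rewrite !mxE (dE i j) /ev /= /horner_eval.
  rewrite /ratfun_eval !rmorphM /= !hornerM.
  have : (map_poly (real_complex R) (\d_(repr (M i j)))).[z] != 0.
    move: dz; rewrite (dE i j) rmorphM /= hornerM mulf_eq0 negb_or.
    by case/andP.
  by move=> dijz; field.
have : \det (map_mx ev P) = 0 by rewrite det_map_mx P0 rmorph0.
rewrite PMz detZ => /eqP; rewrite mulf_eq0 expf_eq0 (negPf dz) andbF /=.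
by move/eqP.
Qed.

Lemma ratfun_eval_const (R : realType) (c : R) :
  tends_at_infinity (ratfun_eval (tofrac c%:P)) c%:C.
Proof.
set g := tofrac _.
have [M HM] := poly_eventually_neq0 (denom_ratioP (repr g)).
move=> e e0; exists M => z /HM dz.
suff -> : ratfun_eval g z = c%:C by rewrite subrr normr0 ltcR.
have /eqP := ratfun_denominator g.
rewrite {1}/g -rmorphM /= tofrac_eq => /eqP gE.
by rewrite /ratfun_eval -gE rmorphM /= hornerM map_polyC hornerC mulfK.
Qed.

Lemma admissible_regular (R : realType) n (E : {set 'I_n * 'I_n})
    (G : 'M[ratfun R]_n) : admissible E G -> principally_regular G.
Proof.
case=> _ _ [L [GL Lminors]]; apply: principal_minors_regular => S.
apply: (det_ratfun_neq0 _ (Lminors S)) => i j.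
by rewrite ![submx_of _ _ _ _ _]mxE; apply: GL.
Qed.

(** * Admissible matrices with a hidden state *)

(** For constant weights, properness is immediate and the limit at infinity of
I - G is I - G itself. *)
Lemma admissible_constant (R : realType) n (E : {set 'I_n * 'I_n})
    (A : 'M[R]_n) :
  supported_on E A ->
  (forall S : {set 'I_n}, \det (submx_of (1%:M - A) S S) != 0) ->
  admissible E (map_mx (@tofrac {poly R} \o polyC) A : 'M[ratfun R]_n).
Proof.
move=> supp minors; split=> [i j|i j|].
- exists (A i j)%:P, 1; rewrite oner_neq0 mxE rmorph1 divr1 size_poly1.
  by split=> //; apply: size_polyC_leq1.
- by rewrite mxE /= tofrac_eq0 polyC_eq0; apply: supp.
exists (map_mx (real_complex R) (1%:M - A)); split=> [i j|S].
  have -> : (1%:M - map_mx (@tofrac {poly R} \o polyC) A) i j =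
      tofrac ((1%:M - A) i j)%:P :> ratfun R.
    by rewrite !mxE /= polyCB polyC_natr tofracB rmorph_nat.
  by rewrite [X in tends_at_infinity _ X]mxE; apply: ratfun_eval_const.
by rewrite /submx_of -map_mxsub det_map_mx fmorph_eq0; apply: minors.
Qed.

(** The witness is the length of a shortest walk from U, and j is the vertex
before i on such a walk. *)
Lemma reachable_rank n (E : {set 'I_n * 'I_n}) (U : {set 'I_n}) :
  exists d : 'I_n -> nat, forall i, reachable E U i -> i \notin U ->
    exists j, [/\ reachable E U j, (j, i) \in E & (d j < d i)%N].
Proof.
pose walk k i := [exists u in U, [exists p : k.-tuple 'I_n,
  path (edge_rel E) u p && (last u p == i)]].
have walkP u p : u \in U -> path (edge_rel E) u p -> walk (size p) (last u p).
  move=> uU up; apply/exists_inP; exists u => //; apply/existsP.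
  by exists (in_tuple p); rewrite up /=.
have minimal i : exists d : nat, reachable E U i ->
    walk d i /\ forall k, walk k i -> (d <= k)%N.
  case: (boolP [exists u in U, connect (edge_rel E) u i]) => [|Nri]; last first.
    by exists 0 => /reachableP ri; rewrite ri in Nri.
  case/exists_inP=> u uU /connectP[p up ->].
  have ex : exists k, walk k (last u p) by exists (size p); apply: walkP.
  by exists (ex_minn ex) => _; case: ex_minnP.
have [d dP] := fin_all_exists minimal.
exists d => i ri iU; have [/exists_inP[u uU /existsP[p upi]] _] := dP i ri.
move: (size_tuple p) upi.
case/lastP: (tval p) => [|q k] dq /andP[up /eqP ui].
  by rewrite -ui uU in iU.
move: up ui; rewrite rcons_path last_rcons => /andP[uq qk] ki.
have rj : reachable E U (last u q).
  by apply/reachableP/exists_inP; exists u => //; apply/connectP; exists q.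
exists (last u q); split=> //; first by rewrite -ki.
by rewrite -dq size_rcons ltnS; apply: (dP _ rj).2; apply: walkP.
Qed.

(** The state is x_i = t^(d i) on the reachable vertices outside D, and J i
is the set of in-neighbours of i that contribute to the equation at i. Every
edge has weight t^N, except the edge from pi i in J i to i, whose weight
c i (pi i) is the solution of the equation at i. The exponent N exceeds
every d i, which keeps all exponents in c positive and makes t^(d i - d j) its
lowest term when i lies outside D. *)
Lemma polynomial_hidden_state (R : numDomainType) n (E E' : {set 'I_n * 'I_n})
    (U D : {set 'I_n}) :
  E' \subset E ->
  (forall e, e \in E' -> e.1 \notin D) ->
  (forall k j, k \in D :\: U -> ~ unique_reachable_in_neighbour E' U k j) ->
  ~~ (U \subset D) ->
  exists (A : 'M[{poly R}]_n) (x : 'cV[{poly R}]_n),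
    [/\ supported_on E A, forall i j, (A i j).[0] = 0,
        forall i, i \notin U -> x i 0 = (restrict_edges E' A *m x) i 0,
        forall i, i \in D -> x i 0 = 0 & exists i, x i 0 != 0].
Proof.
move=> /subsetP sub outD nuniq UD.
have [d dP] := reachable_rank E' U.
pose r i := [exists u in U, connect (edge_rel E') u i].
pose J i := [set j | ((j, i) \in E') && r j].
have parent i : exists j, i \notin U -> J i != set0 ->
    j \in J i /\ (i \notin D -> (d j < d i)%N).
  case: (boolP (i \in U)) => [|iU]; first by exists i.
  case: (set_0Vmem (J i)) => [->|[j jJ]]; first by exists i; rewrite eqxx.
  case: (boolP (i \in D)) => iD; first by exists j.
  have ri : reachable E' U i.
    move: jJ; rewrite inE => /andP[ji /reachableP rj].
    exact: reachable_edge rj ji.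
  have [k [/reachableP rk ki dki]] := dP i ri iU.
  by exists k => _ _; rewrite inE ki.
have [pi piP] := fin_all_exists parent.
pose N := (\max_i d i).+1.
have dN i : (d i < N)%N by rewrite ltnS; apply: leq_bigmax.
pose c i j : {poly R} := (if i \in D then 0 else 'X^(d i - d j)) -
  \sum_(l in J i | l != j) 'X^(N + d l - d j).
pose A : 'M[{poly R}]_n := \matrix_(i, j) if (j, i) \notin E then 0 else
  if [&& i \notin U, j \in J i & j == pi i] then c i j else 'X^N.
pose x : 'cV[{poly R}]_n := \col_i if r i && (i \notin D) then 'X^(d i) else 0.
have JD i j : j \in J i -> j \notin D by rewrite inE => /andP[/outD].
have piP' i j : i \notin U -> j \in J i -> j = pi i -> i \notin D ->
    (d j < d i)%N.
  move=> iU jJ -> iD; apply: (piP i iU _).2 => //.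
  by apply/set0Pn; exists j.
exists A, x; split.
- move=> i j; rewrite mxE; case: ifP => [/negPf ->|/negbFE ->].
    by rewrite eqxx.
  split=> // _; case: ifP => [/and3P[iU jJ /eqP jpi]|_]; last first.
    by rewrite expf_neq0 // polyX_eq0.
  rewrite /c; case: ifP => iD.
    have [l lJ lj] : exists2 l, l \in J i & l != j.
      apply/exists_inP/contraT; rewrite negb_exists_in => /forall_inP Nl.
      case: (nuniq i j); first by rewrite inE iU.
      move: jJ; rewrite inE => /andP[ji /reachableP rj]; split=> // l [li rl].
      apply/esym/eqP; rewrite -[_ == _]negbK Nl // inE li.
      exact/reachableP.
    (* A nonempty sum of powers of t has a positive value at t = 1. *)
    rewrite sub0r oppr_eq0; apply/eqP => /(congr1 (fun p => p.[1])) /eqP.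
    rewrite horner_sum horner0 psumr_eq0 => [/allP/(_ l)|k _].
      rewrite mem_index_enum lJ lj /= hornerXn expr1n oner_eq0.
      by move/(_ isT).
    by rewrite hornerXn expr1n ler01.
  have dji := piP' i j iU jJ jpi (negbT iD).
  (* The powers in the sum have exponents above d i - d j, as d i < N. *)
  apply/eqP => /(congr1 (fun p : {poly R} => p`_(d i - d j))) /eqP.
  rewrite coefB coefXn eqxx coef0 coef_sum big1 ?subr0 ?oner_eq0 // => l _.
  rewrite coefXn; have := dN i; case: eqP => // E0; lia.
- move=> i j; rewrite mxE; case: ifP => _; first by rewrite horner0.
  case: ifP => [/and3P[iU jJ /eqP jpi]|_]; last by rewrite hornerXn expr0n.
  rewrite /c hornerD hornerN horner_sum big1 ?subr0 => [|l _]; last first.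
    rewrite hornerXn expr0n; have := dN j; case: eqP => // E0; lia.
  case: ifP => iD; first by rewrite horner0.
  have dji := piP' i j iU jJ jpi (negbT iD).
  by rewrite hornerXn expr0n; case: eqP => // E0; lia.
- move=> i iU; rewrite [RHS]mxE (bigID (mem (J i))) /= addrC big1 ?add0r.
    have [J0|[j jJ]] := set_0Vmem (J i).
      rewrite J0 big_set0 mxE; case: ifP => // /andP[/reachableP ri iD].
      have [j [/reachableP rj ji _]] := dP i ri iU.
      suff : j \in J i by rewrite J0 inE.
      by rewrite inE ji.
    have [pJ _] : pi i \in J i /\ (i \notin D -> (d (pi i) < d i)%N).
      by apply: piP => //; apply/set0Pn; exists j.
    have ri : r i.
      move: jJ; rewrite inE => /andP[ji /reachableP rj].
      exact/reachableP/(reachable_edge rj ji).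
    have term l : l \in J i -> restrict_edges E' A i l * x l 0 =
        (if l == pi i then c i l else 'X^N) * 'X^(d l).
      move=> lJ; rewrite !mxE (JD i l lJ) iU lJ /=.
      by move: lJ; rewrite inE => /andP[li ->]; rewrite li (sub _ li).
    rewrite (bigD1 (pi i)) //= term // eqxx /c mulrBl mulr_suml.
    rewrite -addrA addrC [X in X + _](_ : _ = 0) ?add0r.
      rewrite mxE ri /=; case: (boolP (i \in D)) => iD /=.
        by rewrite mul0r.
      by rewrite -exprD subnK // ltnW // piP'.
    rewrite addrC; apply/eqP; rewrite subr_eq0; apply/eqP.
    apply: eq_bigr => l /andP[lJ /negPf lpi]; rewrite term // lpi -!exprD.
    by congr ('X^_); have := dN (pi i); lia.
  move=> j; rewrite inE negb_and !mxE => /orP[/negPf->|/negPf->].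
    by rewrite mul0r.
  by rewrite mulr0.
- by move=> i iD; rewrite mxE iD andbF.
have /subsetPn[u uU uD] := UD; exists u.
have ru : r u by apply/exists_inP; exists u.
by rewrite mxE ru uD expf_neq0 // polyX_eq0.
Qed.

(** Specialize t to a real number at which x, the edge weights and the
principal minors do not vanish. The minors are nonzero polynomials since their
value at t = 0 is 1. *)
Lemma hidden_state (R : realType) n (E E' : {set 'I_n * 'I_n})
    (U D : {set 'I_n}) :
  E' \subset E ->
  (forall e, e \in E' -> e.1 \notin D) ->
  (forall k j, k \in D :\: U -> ~ unique_reachable_in_neighbour E' U k j) ->
  ~~ (U \subset D) ->
  exists A : 'M[R]_n,
    [/\ supported_on E A,
        forall S : {set 'I_n}, \det (submx_of (1%:M - A) S S) != 0 &
        exists x : 'cV[R]_n,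
        [/\ forall i, i \notin U -> x i 0 = (restrict_edges E' A *m x) i 0,
            forall i, i \in D -> x i 0 = 0 & x != 0]].
Proof.
move=> sub outD nuniq UD.
have [A [x [supp A0 xU xD [u xu]]]] :=
  polynomial_hidden_state R sub outD nuniq UD.
pose q := x u 0 * \prod_(p : 'I_n * 'I_n | (p.2, p.1) \in E) A p.1 p.2 *
  \prod_(S : {set 'I_n}) \det (submx_of (1%:M - A) S S).
have [|e] := @poly_nonroot R q.
  rewrite !mulf_neq0 //; first by apply/prodf_neq0 => -[i j] /supp.
  apply/prodf_neq0 => S _; apply/eqP => /(congr1 (horner_eval 0)).
  rewrite -det_map_mx /horner_eval horner0.
  have -> : map_mx (horner_eval 0) (submx_of (1%:M - A) S S) = 1%:M.
    apply/matrixP=> i j; rewrite !mxE /horner_eval hornerD hornerN A0 subr0.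
    by rewrite (inj_eq enum_val_inj) -polyC_natr hornerC.
  by rewrite det1 => /eqP; rewrite oner_eq0.
rewrite /q !hornerM !mulf_eq0 !negb_or => /andP[/andP[xue Ae] de].
pose ev : {poly R} -> R := horner_eval e.
have ev0 : ev 0 = 0 by apply: horner0.
have detE S : ev (\det (submx_of (1%:M - A) S S)) =
    \det (submx_of (1%:M - map_mx ev A) S S).
  rewrite -[RHS]/(\det (mxsub _ _ _)) -(map_mx1 ev) -map_mxB -map_mxsub.
  by rewrite det_map_mx.
exists (map_mx ev A); split.
- move=> i j; rewrite mxE; split=> [|ji].
    by move=> Aij; apply/supp; apply: contraNneq Aij => ->; rewrite ev0.
  move: Ae; rewrite horner_prod => /prodf_neq0/(_ (i, j) ji); exact.
- move=> S; rewrite -detE; move: de; rewrite horner_prod => /prodf_neq0.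
  exact.
exists (map_mx ev x); split.
- move=> i /xU xi; rewrite mxE xi.
  by rewrite map_restrict_edges // -map_mxM [RHS]mxE.
- by move=> i /xD xi; rewrite mxE xi ev0.
by apply: contraNneq xue => /colP/(_ u); rewrite !mxE => xu0; apply/eqP.
Qed.

Theorem theorem1 (R : realType) (n : nat) (E : {set 'I_n * 'I_n})
    (U W D : {set 'I_n}) (E_simple : simple_digraph E)
    (D_derived : derived_vertex_set E U W D) :
  (forall G : 'M[ratfun R]_n, admissible E G ->
     \rank (submx_of (transfer_matrix G) W U) = #|U|) <->
  U \subset D.
Proof.
have [E' [steps final]] := D_derived.
have invariant (G : 'M[ratfun R]_n) : admissible E G ->
    principally_regular (restrict_edges E' G) /\
    (\rank (submx_of (transfer_matrix G) W U) = #|U| <->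
     observable (restrict_edges E' G) U D).
  move=> adm; have reg := admissible_regular adm.
  have supp : supported_on E G := admissible_support adm.
  have GE := restrict_edges_id supp.
  have [||reg' obs] := simplification_observable supp steps.
  - exact: subxx.
  - by rewrite GE.
  split=> //; rewrite GE in obs; apply: iff_trans (iff_sym obs).
  exact/rank_transfer_observable/regular_unitmx.
split=> [rk|UD G /invariant[reg ->]]; last exact: regular_observable.
apply/contraT => UD.
have sub : E' \subset E := simplification_subset steps.
have outD e : e \in E' -> e.1 \notin D.
  have [<-] := final _ (RemoveOutEdges U E' D).
  by rewrite inE => /andP[].
have nuniq k j : k \in D :\: U -> ~ unique_reachable_in_neighbour E' U k j.
  move=> kDU jk; have [DE] := final _ (ReplaceVertex kDU jk).
  have [/(subsetP sub) jkE _] := jk.1.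
  have : k \in j |: (D :\ k) by rewrite DE; move: kDU; rewrite inE => /andP[].
  rewrite !inE eqxx orbF => /eqP kj.
  by have := E_simple k; rewrite {1}kj jkE.
have [A [supp minors [x [xU xD x0]]]] := hidden_state R sub outD nuniq UD.
have adm := admissible_constant supp minors.
have [_ [/(_ (rk _ adm)) obs _]] := invariant _ adm.
pose f : R -> ratfun R := @tofrac {poly R} \o polyC.
have f0 : f 0 = 0 by rewrite /f /= polyC0 tofrac0.
suff fx0 : map_mx f x = 0.
  apply: contraNeq x0 => _; apply/eqP/colP=> i; have /colP/(_ i) := fx0.
  by rewrite !mxE => /eqP; rewrite fmorph_eq0 => /eqP.
apply: obs => i; last by move=> /xD xi; rewrite mxE xi f0.
move=> /xU xi; rewrite mxE xi.
by rewrite map_restrict_edges // -map_mxM [RHS]mxE.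
Qed.
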